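(* Let $G$ be a torsion-free abelian group such that its endomorphism ring $\operatorname{End}(G)$ has finite rank. Then $G$ has a decomposition $G = A \oplus H$ where $A$ is completely decomposable of finite rank and $H$ is clipped.
   Context: The rank of $\operatorname{End}(G)$ is the rank of its additive group, which is a torsion-free abelian group. A torsion-free abelian group is completely decomposable if it is a direct sum (possibly empty) of groups of rank $1$; it is clipped if it has no direct summand of rank $1$. *)

(* Defs.v *)
From HB Require Import structures.
From mathcomp Require Import all_boot all_algebra.
From mathcomp Require Import boolp classical_sets cardinality fsbigop.

Set Implicit Arguments.
Unset Strict Implicit.
Unset Printing Implicit Defensive.

Import GRing.Theory.
Local Open Scope ring_scope.

(* Composition is the product; the ring is a pzRingType rather than a
   nzRingType because it is trivial when V is. *)
Definition End (V : zmodType) : Type := {additive V -> V}.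

Section EndomorphismRing.
Variable V : zmodType.
Implicit Types f g h : End V.

HB.instance Definition _ := gen_eqMixin (End V).
HB.instance Definition _ := gen_choiceMixin (End V).

Lemma End_eqP f g :
  (f : {additive V -> V}) =1 (g : {additive V -> V}) -> f = g.
Proof.
case: f g => [f [[pf]]] [g [[pg]]] /= /funext fg; subst g.
by rewrite (Prop_irrelevance pf pg).
Qed.

Definition End_zero : End V := \0 : {additive V -> V}.
Definition End_opp f : End V := \- (f : {additive V -> V}).
Definition End_add f g : End V :=
  (f : {additive V -> V}) \+ (g : {additive V -> V}).
Definition End_one : End V := idfun : {additive V -> V}.
Definition End_mul f g : End V :=
  (f : {additive V -> V}) \o (g : {additive V -> V}).

Fact End_addA : associative End_add.
Proof. by move=> f g h; apply: End_eqP => x /=; rewrite addrA. Qed.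

Fact End_addC : commutative End_add.
Proof. by move=> f g; apply: End_eqP => x /=; rewrite addrC. Qed.

Fact End_add0 : left_id End_zero End_add.
Proof. by move=> f; apply: End_eqP => x /=; rewrite add0r. Qed.

Fact End_addN : left_inverse End_zero End_opp End_add.
Proof. by move=> f; apply: End_eqP => x /=; rewrite addNr. Qed.

HB.instance Definition _ := GRing.isZmodule.Build (End V)
  End_addA End_addC End_add0 End_addN.

Fact End_mulA : associative End_mul.
Proof. by move=> f g h; apply: End_eqP. Qed.

Fact End_mul1 : left_id End_one End_mul.
Proof. by move=> f; apply: End_eqP. Qed.

Fact End_mulr1 : right_id End_one End_mul.
Proof. by move=> f; apply: End_eqP. Qed.

Fact End_mulDl : left_distributive End_mul +%R.
Proof. by move=> f g h; apply: End_eqP. Qed.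

Fact End_mulDr : right_distributive End_mul +%R.
Proof. by move=> f g h; apply: End_eqP => x /=; rewrite raddfD. Qed.

HB.instance Definition _ := GRing.Zmodule_isPzRing.Build (End V)
  End_mulA End_mul1 End_mulr1 End_mulDl End_mulDr.

End EndomorphismRing.

(* zmodClosed V is the type of subgroups of V; subgroup A turns one of them
   into an abelian group in its own right. *)
Record subgroup (V : zmodType) (A : zmodClosed V) : Type :=
  Subgroup { subgroup_val : V; _ : subgroup_val \in A }.

HB.instance Definition _ (V : zmodType) (A : zmodClosed V) :=
  [isSub for @subgroup_val V A].
HB.instance Definition _ (V : zmodType) (A : zmodClosed V) :=
  [Choice of subgroup A by <:].
HB.instance Definition _ (V : zmodType) (A : zmodClosed V) :=
  [SubChoice_isSubZmodule of subgroup A by <:].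

Definition torsion_free (V : zmodType) : Prop :=
  forall (n : nat) (x : V), (0 < n)%N -> x *+ n = 0 -> x = 0.

Definition Z_independent (V : zmodType) (n : nat) (v : 'I_n -> V) : Prop :=
  forall c : 'I_n -> int, \sum_(i < n) v i *~ c i = 0 -> forall i, c i = 0.

Definition has_rank (V : zmodType) (n : nat) : Prop :=
  (exists v : 'I_n -> V, Z_independent v) /\
  (forall (m : nat) (v : 'I_m -> V), Z_independent v -> (m <= n)%N).

Definition finite_rank (V : zmodType) : Prop := exists n, has_rank V n.

Definition is_direct_sum2 (V : zmodType) (A B : zmodClosed V) : Prop :=
  forall x : V, exists! p : V * V, [/\ p.1 \in A, p.2 \in B & x = p.1 + p.2].

(* The index type may be infinite. The finiteness condition is needed because
   \sum_(i \in _) is 0 on families of infinite support. *)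
Definition is_direct_sum (V : zmodType) (I : choiceType)
    (A : I -> zmodClosed V) : Prop :=
  forall x : V, exists! f : I -> V,
    [/\ forall i, f i \in A i,
        finite_set [set i | f i != 0]
      & x = \sum_(i \in [set: I]) f i].

Definition completely_decomposable (V : zmodType) : Prop :=
  exists (I : choiceType) (A : I -> zmodClosed V),
    is_direct_sum A /\ forall i, has_rank (subgroup (A i)) 1.

Definition direct_summand (V : zmodType) (A : zmodClosed V) : Prop :=
  exists B : zmodClosed V, is_direct_sum2 A B.

Definition clipped (V : zmodType) : Prop :=
  ~ exists A : zmodClosed V, direct_summand A /\ has_rank (subgroup A) 1.

(* Main.v *)
From HB Require Import structures.
Require Import Defs.
From mathcomp Require Import all_boot all_algebra.
From mathcomp Require Import boolp classical_sets cardinality fsbigop.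

(** Decompositions of [G] with summands [A_1, ..., A_k] of rank 1 correspond to
    orthogonal idempotents [e_1, ..., e_k] of [End G] whose images have rank 1.
    Such idempotents are linearly independent over the integers, so [k] is at
    most the rank of [End G]; when [k] is maximal the complement of the
    [A_i] is clipped, since a rank-1 summand of it would give one more
    idempotent. *)

Set Implicit Arguments.
Unset Strict Implicit.
Unset Printing Implicit Defensive.

Import GRing.Theory.
Local Open Scope ring_scope.

(** * Rank and integral linear independence *)

Lemma common_denominator (m : nat) (u : 'rV[rat]_m) :
  exists (d : int) (c : 'I_m -> int),
    d != 0 /\ forall j, (c j)%:~R = d%:~R * u 0 j :> rat.
Proof.
exists (\prod_j denq (u 0 j)).
exists (fun j => numq (u 0 j) * \prod_(l | l != j) denq (u 0 l)); split.
  by apply/prodf_neq0 => j _; apply: denq_neq0.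
move=> j; rewrite [in RHS](bigD1 j) //= !intrM numqE.
by rewrite [RHS]mulrC mulrA.
Qed.

(** If [m > k], the rational [m] by [k] matrix of the coefficients [z] has a nonzero vector in its
    left kernel; clearing its denominators gives a nontrivial integral relation between the
    [v j]. *)
Lemma independent_le_span (V : zmodType) (k : nat) (a : 'I_k -> V) :
  (forall x, exists (n : int) (z : 'I_k -> int),
     n != 0 /\ x *~ n = \sum_i a i *~ z i) ->
  forall (m : nat) (v : 'I_m -> V), Z_independent v -> (m <= k)%N.
Proof.
move=> span m v v_free; rewrite leqNgt; apply/negP => lt_km.
have /choice[n] := fun j => span (v j).
case/(@choice _ ('I_k -> int)) => z nzP.
pose M : 'M[rat]_(m, k) := \matrix_(j, i) (z j i)%:~R.
have : kermx M != 0.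
  by rewrite kermx_eq0 /row_free ltn_eqF // (leq_ltn_trans (rank_leq_col M)).
case/rowV0Pn=> u /sub_kermxP uM0 u_neq0.
have [d [c [d_neq0 cE]]] := common_denominator u.
(* Since [v j *~ n j] is a combination of the [a i], the factor [n j] makes the kernel relation
   apply. *)
have vnc0 : \sum_j v j *~ (n j * c j) = 0.
  transitivity (\sum_i a i *~ (\sum_j z j i * c j)).
    under eq_bigr => j _ do rewrite mulrzA (nzP j).2 mulrz_suml.
    rewrite exchange_big; apply: eq_bigr => i _; rewrite mulrz_sumr.
    by apply: eq_bigr => j _; rewrite mulrzA.
  apply: big1 => i _.
  have /rowP/(_ i) := uM0; rewrite !mxE => uMi0.
  suff -> : \sum_j z j i * c j = 0 by [].
  apply/eqP; rewrite -(intr_eq0 rat) rmorph_sum /=.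
  transitivity (d%:~R * \sum_j u 0 j * M j i == 0 :> rat).
    rewrite mulr_sumr; congr (_ == _); apply: eq_bigr => j _.
    by rewrite intrM cE !mxE mulrC mulrA.
  by rewrite uMi0 mulr0.
case/rV0Pn: u_neq0 => j; apply/negP; rewrite negbK.
have /eqP := v_free _ vnc0 j; rewrite mulf_eq0 (negPf (nzP j).1) /= => /eqP cj0.
move: (cE j); rewrite cj0 => /esym/eqP.
by rewrite mulf_eq0 intr_eq0 (negPf d_neq0).
Qed.

(** Any member [a] of an independent family of length 1 will do: an [x] with no nonzero multiple in
    the span of [a] would form an independent pair with it. *)
Lemma rank1P (V : zmodType) : has_rank V 1 ->
  exists a : V, (forall c, a *~ c = 0 -> c = 0) /\
    forall x, exists (n z : int), n != 0 /\ x *~ n = a *~ z.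
Proof.
case=> [[v v_free] rank_le1]; exists (v ord0).
have aP c : v ord0 *~ c = 0 -> c = 0.
  by move=> vc0; apply: (v_free (fun=> c) _ ord0); rewrite big_ord1.
split=> // x; apply: contrapT => no_rel.
suff /rank_le1 : @Z_independent V 2 (fun i => if i == ord0 then x else v ord0).
  by [].
move=> c; rewrite big_ord_recl big_ord1 /= => rel.
have c0 : c ord0 = 0.
  apply/eqP/negPn/negP => c0_neq0; apply: no_rel.
  exists (c ord0), (- c (lift ord0 ord0)); split=> //.
  by rewrite mulrNz; apply/eqP; rewrite -addr_eq0 rel.
rewrite c0 mulr0z add0r in rel; move=> i.
by case: (unliftP ord0 i) => [j ->|->] //; rewrite (ord1 j); apply: aP.
Qed.

(** Both groups embed in [W] with the same image, and injective morphisms preserve and reflect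
    integral relations. This compares subgroups that are nested differently. *)
Lemma has_rank_transfer (U V W : zmodType) (f : {additive U -> W})
    (g : {additive V -> W}) (n : nat) :
  injective f -> injective g ->
  (forall x, exists y, g y = f x) -> (forall y, exists x, f x = g y) ->
  has_rank U n -> has_rank V n.
Proof.
have free_transfer (X Y : zmodType) (p : {additive X -> W})
    (q : {additive Y -> W}) m (x : 'I_m -> X) (y : 'I_m -> Y) :
    injective p -> (forall i, q (y i) = p (x i)) ->
    Z_independent x -> Z_independent y.
  move=> p_inj qy x_free c /(congr1 q) yc0; apply: x_free; apply: p_inj.
  rewrite raddf0 -[RHS](raddf0 q) -yc0 !raddf_sum.
  by apply: eq_bigr => i _; rewrite !raddfMz qy.
move=> f_inj g_inj gf fg [[u u_free] rank_le]; split.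
  have /choice[v vP] := fun i => gf (u i).
  by exists v; apply: (free_transfer _ _ f g _ u).
move=> m v v_free; have /choice[w wP] := fun i => fg (v i).
by apply: (rank_le m w); apply: (free_transfer _ _ g f _ v).
Qed.

(** * Fixed subgroups, nested subgroups and projections *)

Section Fixed.
Variable V : zmodType.
Implicit Types f e : End V.

(** For an idempotent [f] this is the image of [f]; as a set of fixed points, membership is an
    equation. *)
Definition fixed_pred f : {pred V} := fun x => f x == x.

Fact fixed_zmod_closed f : zmod_closed (fixed_pred f).
Proof.
split=> [|x y]; first by rewrite unfold_in raddf0.
by rewrite !unfold_in raddfB => /eqP-> /eqP->.
Qed.

HB.instance Definition _ f :=
  GRing.isZmodClosed.Build V (fixed_pred f) (fixed_zmod_closed f).

Definition fixed f : zmodClosed V := fixed_pred f.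

Lemma fixedP f x : reflect (f x = x) (x \in fixed f).
Proof. exact: eqP. Qed.

Lemma fixed_direct_sum e :
  e * e = e -> is_direct_sum2 (fixed e) (fixed (1 - e)).
Proof.
move=> ee x; have eeE y : e (e y) = e y by rewrite -[in RHS]ee.
exists (e x, x - e x); split=> [|[a b] /= [/fixedP ea /fixedP eb ->]].
  split=> /=; [exact/fixedP | apply/fixedP | by rewrite addrC subrK].
  by change (x - e x - e (x - e x) = x - e x); rewrite raddfB eeE subrr subr0.
(* The fixed points of [1 - e] are killed by [e], so [e] recovers the first component. *)
have eb0 : e b = 0 by rewrite -eb; change (e (b - e b) = 0); rewrite raddfB eeE subrr.
by rewrite raddfD ea eb0 addr0 [a + b]addrC addrK.
Qed.

(** Evaluation at [x] is named so that it can be made a morphism, which carries sums and integer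
    multiples from [End V] to [V]. *)
Definition End_eval (x : V) (f : End V) : V := f x.

Fact End_eval_zmod_morphism x : zmod_morphism (End_eval x).
Proof. by []. Qed.

HB.instance Definition _ x :=
  GRing.isZmodMorphism.Build (End V) V (End_eval x) (End_eval_zmod_morphism x).

Lemma End_sumE (k : nat) (f : 'I_k -> End V) x :
  (\sum_i f i : End V) x = \sum_i f i x.
Proof. exact: (raddf_sum (End_eval x)). Qed.

Lemma End_mulrzE f (c : int) x : (f *~ c : End V) x = f x *~ c.
Proof. exact: (raddfMz (End_eval x)). Qed.

End Fixed.

Section Inside.
Variables (V : zmodType) (A B : zmodClosed V).

(** The intersection of [A] and [B], seen as a subgroup of the group [subgroup A] rather than of
    [V]. *)
Definition inside_pred : {pred subgroup A} := fun y => val y \in B.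

Fact inside_zmod_closed : zmod_closed inside_pred.
Proof.
split=> [|x y]; first by change (val (0 : subgroup A) \in B); rewrite raddf0 rpred0.
change (val x \in B -> val y \in B -> val (x - y) \in B); rewrite raddfB.
exact: rpredB.
Qed.

HB.instance Definition _ :=
  GRing.isZmodClosed.Build (subgroup A) inside_pred inside_zmod_closed.

Definition inside : zmodClosed (subgroup A) := inside_pred.

Lemma has_rank_inside (n : nat) : {subset B <= A} ->
  has_rank (subgroup B) n -> has_rank (subgroup inside) n.
Proof.
move=> sBA; pose f : {additive subgroup inside -> V} := val \o val.
apply: (@has_rank_transfer _ _ _ (val : {additive subgroup B -> V}) f).
- exact: val_inj.
- by move=> x y /val_inj/val_inj.
- by move=> [x Bx]; exists (@Subgroup _ inside (Subgroup (sBA x Bx)) Bx).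
- by move=> [y By]; exists (Subgroup (By : val y \in B)).
Qed.

End Inside.

(** The first component is additive because the difference of two decompositions is a decomposition
    of the difference, and decompositions are unique. *)
Lemma direct_sum2_proj (V : zmodType) (A B : zmodClosed V) :
  is_direct_sum2 A B ->
  exists p : {additive V -> V},
    (forall x, p x \in A) /\ {in A, forall x, p x = x}.
Proof.
move=> AB; have /choice[p pP] := AB.
have p_uniq x a b : a \in A -> b \in B -> x = a + b -> (p x).1 = a.
  by move=> Aa Bb xE; rewrite ((pP x).2 (a, b)).
have p_additive : zmod_morphism (fun x => (p x).1).
  move=> x y; have [[[Ax Bx xE] _] [[Ay By yE] _]] := (pP x, pP y).
  apply: (p_uniq _ _ ((p x).2 - (p y).2)); rewrite ?rpredB //.
  by rewrite {1}xE {1}yE opprD addrACA.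
pose pM := GRing.isZmodMorphism.Build _ _ _ p_additive.
pose q : {additive V -> V} := HB.pack (fun x => (p x).1) pM.
exists q; split=> [x|x Ax]; first by case: (pP x) => [[]].
by apply: (p_uniq _ _ 0); rewrite ?rpred0 ?addr0.
Qed.

(** * Orthogonal idempotents in a ring *)

Definition orthogonal_idempotents (R : pzRingType) (k : nat) (e : 'I_k -> R) :=
  forall i j, e i * e j = if i == j then e i else 0.

Section OrthogonalIdempotents.
Variables (R : pzRingType) (k : nat) (e : 'I_k -> R).
Hypothesis e_orth : orthogonal_idempotents e.

Lemma sum_idempotents_mulr j : (\sum_i e i) * e j = e j.
Proof.
rewrite mulr_suml (bigD1 j) //= e_orth eqxx big1 ?addr0 // => i /negPf ij.
by rewrite e_orth ij.
Qed.

Lemma sum_idempotents_mull j : e j * (\sum_i e i) = e j.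
Proof.
rewrite mulr_sumr (bigD1 j) //= e_orth eqxx big1 ?addr0 // => i /negPf ij.
by rewrite e_orth eq_sym ij.
Qed.

Lemma sum_idempotents_idem : (\sum_i e i) * (\sum_i e i) = \sum_i e i.
Proof. by rewrite mulr_suml; apply: eq_bigr => i _; apply: sum_idempotents_mull. Qed.

Lemma orthogonal_idempotents_cons (p : R) :
  p * p = p -> (forall i, e i * p = 0) -> (forall i, p * e i = 0) ->
  orthogonal_idempotents (fun i => if unlift ord0 i is Some j then e j else p).
Proof.
move=> pp ep pe i j.
case: (unliftP ord0 i) => [i' ->|->]; case: (unliftP ord0 j) => [j' ->|->];
  rewrite ?liftK ?unlift_none //.
Qed.

End OrthogonalIdempotents.

(** * Orthogonal idempotents with images of rank 1 *)

Section RankOneIdempotents.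
Variables (V : zmodType) (k : nat) (e : 'I_k -> End V).
Hypothesis e_orth : orthogonal_idempotents e.
Hypothesis e_rank : forall i, has_rank (subgroup (fixed (e i))) 1.

Let E : End V := \sum_i e i.

Lemma idempotentsE i j x : e i (e j x) = if i == j then e i x else 0.
Proof.
have /(congr1 (End_eval x)) := e_orth i j.
by rewrite /End_eval /= => ->; case: eqP.
Qed.

Lemma sub_fixed_sum i : {subset fixed (e i) <= fixed E}.
Proof.
move=> x /fixedP <-; apply/fixedP.
exact: (congr1 (End_eval x) (sum_idempotents_mulr e_orth i)).
Qed.

(** Each [a i] generates the image of [e i] up to nonzero integer multiples. *)
Lemma rank1_generators : exists a : 'I_k -> V,
  forall i, [/\ e i (a i) = a i, forall c, a i *~ c = 0 -> c = 0
    & forall x, exists (n z : int), n != 0 /\ e i x *~ n = a i *~ z].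
Proof.
suff /choice[a aP] i : exists a, [/\ e i a = a, forall c, a *~ c = 0 -> c = 0
    & forall x, exists (n z : int), n != 0 /\ e i x *~ n = a *~ z].
  by exists a.
have [[a /= ea] [a_free a_gen]] := rank1P (e_rank i).
exists a; split=> [|c ac0|x]; first exact/fixedP.
  by apply: a_free; apply: val_inj; rewrite raddfMz.
have ex : e i x \in fixed (e i) by apply/fixedP; rewrite idempotentsE eqxx.
have [n [z [n_neq0 /(congr1 val)]]] := a_gen (Subgroup ex).
by rewrite !raddfMz => nz; exists n, z.
Qed.

(** Evaluating a relation at [a j] and then applying [e j] leaves only [a j *~ c j = 0]. *)
Lemma rank1_idempotents_independent : Z_independent e.
Proof.
move=> c ec0 j; have [a /(_ j)[ea a_free _]] := rank1_generators.
apply: a_free; have ec0a : (\sum_i e i *~ c i : End V) (a j) = 0 by rewrite ec0.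
move/(congr1 (e j)): ec0a; rewrite End_sumE raddf0 raddf_sum => <-.
rewrite (bigD1 j) //= big1 => [|i /negPf ij]; rewrite End_mulrzE raddfMz.
  by rewrite !ea addr0.
by rewrite idempotentsE eq_sym ij mul0rz.
Qed.

Lemma fixed_sum_decomp (y : subgroup (fixed E)) : val y = \sum_i e i (val y).
Proof. by rewrite -End_sumE; apply/esym/fixedP/(valP y). Qed.

Lemma fixed_sum_completely_decomposable :
  completely_decomposable (subgroup (fixed E)).
Proof.
exists 'I_k, (fun i => inside (fixed E) (fixed (e i))); split; last first.
  by move=> i; apply: has_rank_inside; [apply: sub_fixed_sum | apply: e_rank].
move=> y.
have eyP i : e i (val y) \in fixed (e i).
  by apply/fixedP; rewrite idempotentsE eqxx.
(* The index type is finite, so the finitely supported sum is an ordinary one. *)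
have sumE (f : 'I_k -> subgroup (fixed E)) :
    \sum_(i \in [set: 'I_k]%classic) f i = \sum_i f i.
  have -> : ([set: 'I_k] = [set` enum 'I_k])%classic.
    by apply/seteqP; split=> i //= _; rewrite mem_enum.
  by rewrite -fsbig_seq ?enum_uniq // big_enum.
exists (fun i => Subgroup (sub_fixed_sum (eyP i))); split.
  split=> [i||]; [exact: eyP | exact: finite_finset | rewrite sumE].
  by apply: val_inj; rewrite raddf_sum [LHS]fixed_sum_decomp.
move=> f [f_in _ yE]; apply/funext => i; apply: val_inj.
change (e i (val y) = val (f i)).
(* Applying [e i] to any decomposition of [y] kills every component but the [i]-th. *)
rewrite yE sumE !raddf_sum (bigD1 i) //= big1 => [|j /negPf ji].
  by rewrite addr0; apply/fixedP/f_in.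
by rewrite -(fixedP _ _ (f_in j)) idempotentsE eq_sym ji.
Qed.

(** The [a i] are independent, and every element of the sum has a nonzero multiple in their span. *)
Lemma fixed_sum_has_rank : has_rank (subgroup (fixed E)) k.
Proof.
have [a aP] := rank1_generators.
have aE i : a i \in fixed E by apply/(@sub_fixed_sum i)/fixedP; case: (aP i).
pose b i : subgroup (fixed E) := Subgroup (aE i).
split.
  exists b => c /(congr1 val); rewrite raddf_sum raddf0 => ac0 j.
  case: (aP j) => eaj a_free _; apply: a_free.
  have /(congr1 (e j)) := ac0; rewrite raddf0 raddf_sum => <-.
  rewrite (bigD1 j) // big1 => [|i /negPf ij]; rewrite !raddfMz /=.
    by rewrite eaj addr0.
  by case: (aP i) => <- _ _; rewrite idempotentsE eq_sym ij mul0rz.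
apply: (@independent_le_span _ _ b) => y.
have /choice[n] i : exists n : int, exists z : int,
    n != 0 /\ e i (val y) *~ n = a i *~ z by case: (aP i).
case/choice=> z nzP.
(* The product of the [n i] is a common multiplier for all the components [e i (val y)]. *)
exists (\prod_i n i), (fun i => z i * \prod_(j | j != i) n j); split.
  by apply/prodf_neq0 => i _; case: (nzP i).
apply: val_inj; rewrite raddfMz raddf_sum.
transitivity ((\sum_i e i (val y)) *~ \prod_i n i).
  by rewrite -fixed_sum_decomp.
rewrite mulrz_suml.
apply: eq_bigr => i _; rewrite raddfMz [in LHS](bigD1 i) //= !mulrzA.
by case: (nzP i) => _ ->.
Qed.

(** The idempotent [p] is [1 - E] onto the complement, followed by the projection [q] onto [B] and
    the inclusion into [V]. *)
Lemma new_idempotent (B : zmodClosed (subgroup (fixed (1 - E)))) :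
  direct_summand B -> has_rank (subgroup B) 1 ->
  exists p : End V, [/\ p * p = p, forall i, e i * p = 0,
    forall i, p * e i = 0 & has_rank (subgroup (fixed p)) 1].
Proof.
case=> C /direct_sum2_proj[q [qB q_id]] B_rank.
have eE i x : e i (E x) = e i x.
  exact: (congr1 (End_eval x) (sum_idempotents_mull e_orth i)).
have Ee i x : E (e i x) = e i x.
  exact: (congr1 (End_eval x) (sum_idempotents_mulr e_orth i)).
have EE x : E (E x) = E x.
  exact: (congr1 (End_eval x) (sum_idempotents_idem e_orth)).
have rH x : (1 - E) x \in fixed (1 - E).
  by apply/fixedP; change (x - E x - E (x - E x) = x - E x);
    rewrite raddfB EE subrr subr0.
have r_additive : zmod_morphism (fun x => Subgroup (rH x)).
  by move=> x y; apply: val_inj; rewrite [RHS]raddfB; exact: raddfB.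
pose rM := GRing.isZmodMorphism.Build _ _ _ r_additive.
pose r : {additive V -> subgroup (fixed (1 - E))} := HB.pack (fun x => _) rM.
have r_val y : r (val y) = y.
  by apply: val_inj; change ((1 - E) (val y) = val y); apply/fixedP/(valP y).
have Eval (y : subgroup (fixed (1 - E))) : E (val y) = 0.
  have yE : val y - E (val y) = val y by exact: (fixedP _ _ (valP y)).
  by rewrite -yE raddfB EE subrr.
pose p : End V := val \o (q \o r).
have pE x : p x = val (q (r x)) by [].
exists p; split.
- by apply: End_eqP => x; change (p (p x) = p x); rewrite !pE r_val q_id.
(* Here [e i = e i * E], and [E] vanishes on the complement, where [p] takes its values. *)
- by move=> i; apply: End_eqP => x; change (e i (p x) = 0);
    rewrite pE -eE Eval raddf0.
(* Conversely, [1 - E] kills the image of [e i]. *)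
- move=> i; apply: End_eqP => x; change (p (e i x) = 0); rewrite pE.
  suff -> : r (e i x) = 0 by rewrite !raddf0.
  by apply: val_inj; change (e i x - E (e i x) = 0); rewrite Ee subrr.
(* The fixed points of [p] and the elements of [B] form the same subset of [V]. *)
pose f : {additive subgroup B -> V} := val \o val.
apply: (@has_rank_transfer _ _ _ f (val : {additive subgroup (fixed p) -> V})).
- by move=> x y /val_inj/val_inj.
- exact: val_inj.
- move=> x; have px : f x \in fixed p.
    by apply/fixedP; rewrite pE r_val q_id //; apply: valP.
  by exists (Subgroup px).
- by move=> y; exists (Subgroup (qB (r (val y)))); apply: (fixedP p _ (valP y)).
- exact: B_rank.
Qed.

End RankOneIdempotents.

(** * The decomposition from a family of maximal length *)

Theorem corollary2p12 (G : zmodType) (hG : torsion_free G)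
    (hEnd : finite_rank (End G)) :
  exists A H : zmodClosed G,
    [/\ is_direct_sum2 A H,
        completely_decomposable (subgroup A),
        finite_rank (subgroup A)
      & clipped (subgroup H)].
Proof.
pose rank1_family k (e : 'I_k -> End G) := orthogonal_idempotents e /\
  forall i, has_rank (subgroup (fixed (e i))) 1.
case: hEnd => n [_ rank_le].
pose P k := `[< exists e : 'I_k -> End G, rank1_family k e >].
have P0 : exists k, P k.
  (* The empty family; the value 0 is a dummy. *)
  by exists 0; apply/asboolP; exists (fun=> 0); split; case.
have P_le k : P k -> (k <= n)%N.
  by case/asboolP=> e [eo er]; apply: rank_le (rank1_idempotents_independent eo er).
case: (ex_maxnP P0 P_le) => k /asboolP[e [eo er]] k_max.
exists (fixed (\sum_i e i)), (fixed (1 - \sum_i e i)); split.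
- exact/fixed_direct_sum/sum_idempotents_idem.
- exact: fixed_sum_completely_decomposable.
- by exists k; apply: fixed_sum_has_rank.
case=> B [B_summand B_rank].
have [p [pp ep pe p_rank]] := new_idempotent eo B_summand B_rank.
(* Adjoining [p] to the family contradicts the maximality of [k]. *)
suff /k_max : P k.+1 by rewrite ltnn.
apply/asboolP; exists (fun i => if unlift ord0 i is Some j then e j else p).
split; first exact: orthogonal_idempotents_cons.
by move=> i; case: unlift.
Qed.
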